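(* An ideal $\mathcal{I}$ on $\mathbf{N}$ is maximal if and only if every real sequence $x=(x_n)_{n\in\mathbf{N}}$ has at most one $\mathcal{I}$-limit point.
   Context: $\mathbf{N}$ denotes the positive integers. An ideal $\mathcal{I}$ on $\mathbf{N}$ is a collection of subsets of $\mathbf{N}$ closed under finite unions and subsets; it is assumed to contain the family $\mathrm{Fin}$ of finite subsets of $\mathbf{N}$ and to be different from $\mathcal{P}(\mathbf{N})$. An ideal is maximal if it is maximal with respect to inclusion among such ideals. An $\mathcal{I}$-limit point of a real sequence $x$ is an $\ell\in\mathbf{R}$ such that $\lim_{k\to\infty}x_{n_k}=\ell$ for some subsequence $(x_{n_k})$ with $\{n_k:k\in\mathbf{N}\}\notin\mathcal{I}$. *)

(* Defs.v *)
From HB Require Import structures.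
From mathcomp Require Import all_boot all_order all_algebra.
From mathcomp Require Import all_classical all_reals all_analysis.

Set Implicit Arguments.
Unset Strict Implicit.
Unset Printing Implicit Defensive.

Import Order.TTheory GRing.Theory Num.Theory.
Import numFieldNormedType.Exports.

Local Open Scope classical_set_scope.
Local Open Scope ring_scope.

Definition posint : Type := {n : nat | (0 < n)%N}.

(* Closure under the empty union is a consequence of [ideal_fin]. *)
Record is_ideal (I : set (set posint)) : Prop := IsIdeal {
  ideal_setU : forall A B : set posint, I A -> I B -> I (A `|` B);
  ideal_subset : forall A B : set posint, A `<=` B -> I B -> I A;
  ideal_fin : forall A : set posint, finite_set A -> I A;
  ideal_proper : I <> setT
}.

Definition is_maximal_ideal (I : set (set posint)) : Prop :=
  is_ideal I /\
  forall J : set (set posint), is_ideal J -> I `<=` J -> J = I.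

(* The subsequence of [x] along [n] is [x (n k)], with [k] counted from 0. *)
Definition ideal_limit_point (R : realType) (I : set (set posint))
    (x : posint -> R) (l : R) : Prop :=
  exists n : nat -> posint,
    [/\ forall j k : nat, (j < k)%N -> (val (n j) < val (n k))%N,
        x (n k) @[k --> \oo] --> l
      & ~ I (range n)].

(* Main.v *)
(* An ideal is maximal iff it contains every set or its complement. If neither
   [A] nor its complement is in [I], the indicator of [A] has the two I-limit
   points 0 and 1. Conversely, if [I] is maximal, two index sets outside [I]
   have complements in [I], so their intersection is not in [I], hence is
   infinite, and the limits along the two index sets agree. *)
Require Import Defs.
From mathcomp Require Import all_boot all_order all_algebra.
From mathcomp Require Import all_classical all_reals all_analysis.

Local Open Scope classical_set_scope.
Local Open Scope ring_scope.

Import Order.TTheory GRing.Theory Num.Theory.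
Import numFieldNormedType.Exports.

Lemma infinite_posint_least_ge (A : set posint) (m : nat) : infinite_set A ->
  exists a, [/\ A a, (m <= val a)%N &
    forall b, A b -> (m <= val b)%N -> (val a <= val b)%N].
Proof.
move=> Ainf.
have [a Aa ma] : exists2 a, A a & (m <= val a)%N.
  (* If no element of [A] reached [m], the injection [val] would map [A] into the finite set of
     naturals below [m]. *)
  apply: contrapT => noa; apply: Ainf.
  have vinj : injective (val : posint -> nat) := val_inj.
  rewrite -(eq_finite_set (inj_card_eq (in2W vinj))).
  apply: sub_finite_set (finite_II m) => _ [a Aa <-] /=.
  by rewrite ltnNge; apply/negP => ma; apply: noa; exists a.
pose P k := `[< exists2 b, A b & (m <= val b)%N /\ val b = k >].
have exP : exists k, P k by exists (val a); apply/asboolP; exists a.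
have [k /asboolP[b Ab [mb <-]] bmin] := ex_minnP exP.
exists b; split => // c Ac mc; apply: bmin; apply/asboolP; by exists c.
Qed.

(** Greedy enumeration: each term is the least element of [A] beyond the previous one, so no element
    is skipped. *)
Lemma infinite_posint_enum (A : set posint) : infinite_set A ->
  exists n : nat -> posint,
    (forall j k : nat, (j < k)%N -> (val (n j) < val (n k))%N) /\ range n = A.
Proof.
move=> Ainf.
have [f fP] := choice (fun m => infinite_posint_least_ge A m Ainf).
pose n := fix n k := if k is k'.+1 then f (val (n k')).+1 else f 0%N.
have An k : A (n k).
  by case: k => [|k] /=; [case: (fP 0%N) | case: (fP (val (n k)).+1)].
have nS k : (val (n k) < val (n k.+1))%N by case: (fP (val (n k)).+1).
have nlt : forall j k : nat, (j < k)%N -> (val (n j) < val (n k))%N.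
  exact: (homo_ltn ltn_trans nS).
exists n; split=> //; apply/seteqP; split=> [_ [k _ <-] //|a Aa].
have nge k : (k <= val (n k))%N by elim: k => // k /leq_ltn_trans; exact.
(* Take the first [k] with [val a <= val (n k)]. Either [k] is 0 or [a] lies strictly above the
   previous term, so [a] was a candidate when [n k] was chosen as the least one; hence [n k] is
   [a]. *)
have exk : exists k, (val a <= val (n k))%N by exists (val a).
have [k ank kmin] := ex_minnP exk.
exists k => //; apply/val_inj/eqP; rewrite eqn_leq ank andbT.
case: k ank kmin => [|k] _ kmin /=; first by case: (fP 0%N) => _ _; exact.
case: (fP (val (n k)).+1) => _ _; apply => //.
by rewrite ltnNge; apply/negP => /kmin; rewrite ltnn.
Qed.

(** If [I] contains neither [A] nor its complement, then [I] and [A] generate a strictly larger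
    ideal [J]. Conversely, an ideal above [I] with a new member [A] would also contain the
    complement of [A], hence every set. *)
Lemma maximal_idealP (I : set (set posint)) : is_ideal I ->
  is_maximal_ideal I <-> forall A, I A \/ I (~` A).
Proof.
move=> hI; have IT : ~ I setT.
  move=> IT; apply: (ideal_proper hI); apply/seteqP; split=> // A _.
  exact: ideal_subset hI _ _ (@subsetT _ A) IT.
split=> [[_ Imax] A|Idec].
  apply: contrapT => /not_orP[nIA nIAC].
  pose J : set (set posint) := [set B | exists2 C, I C & B `<=` A `|` C].
  suff JI : J = I.
    apply: nIA; rewrite -JI; exists set0; last exact: subsetUl.
    exact/(ideal_fin hI)/finite_set0.
  apply: Imax; last by move=> B IB; exists B => //; exact: subsetUr.
  split.
  - move=> B B' [C IC BC] [C' IC' BC'].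
    exists (C `|` C'); first exact: (ideal_setU hI).
    by move=> p [/BC|/BC'] []; [left|right; left|left|right; right].
  - by move=> B B' BB' [C IC B'C]; exists C => //; exact: subset_trans B'C.
  - by move=> B Bfin; exists B; [exact: (ideal_fin hI)|exact: subsetUr].
  (* Were [J] improper, [A] and some [C] in [I] would cover everything, so [C] would contain the
     complement of [A]. *)
  - move=> JT; apply: nIAC.
    have [C IC TC] : J setT by rewrite JT.
    by apply: (ideal_subset hI) IC => p nAp; case: (TC p Logic.I).
split=> // J hJ IJ; apply/seteqP; split=> // A JA.
case: (Idec A) => // /IJ JAC; exfalso; apply: (ideal_proper hJ).
apply/seteqP; split=> // B _.
by apply: (ideal_subset hJ) (ideal_setU hJ JA JAC) => p _; rewrite setUv.
Qed.

(** A set outside [I] is infinite, and along its increasing enumeration [x] is constant. *)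
Lemma ideal_limit_point_cst_on (R : realType) (I : set (set posint))
    (x : posint -> R) (l : R) (A : set posint) :
  is_ideal I -> ~ I A -> {in A, x =1 fun=> l} -> ideal_limit_point I x l.
Proof.
move=> hI nIA xl.
have /infinite_posint_enum[n [nlt nA]] : infinite_set A by move=> /(ideal_fin hI).
exists n; split=> //; last by rewrite nA.
rewrite (_ : (fun k => x (n k)) = fun=> l); first exact: cvg_cst.
by apply/funext => k; rewrite xl// inE -nA; exists k.
Qed.

Lemma finite_range_head (n : nat -> posint) (K : nat) : finite_set (n @` `I_K).
Proof. exact/finite_image/finite_II. Qed.

Theorem corollary4p3 (R : realType) (I : set (set posint)) (hI : is_ideal I) :
  is_maximal_ideal I <->
  (forall (x : posint -> R) (l1 l2 : R),
     ideal_limit_point I x l1 -> ideal_limit_point I x l2 -> l1 = l2).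
Proof.
rewrite (maximal_idealP I hI).
split=> [Idec x l1 l2 [n [_ nl1 nI]] [m [_ ml2 mI]]|uniq A]; last first.
  apply: contrapT => /not_orP[nIA nIAC].
  pose x p : R := (p \in A)%:R.
  have : (1 : R) = 0.
    apply: (uniq x).
    - by apply: (ideal_limit_point_cst_on _ _ _ _ A) => // p Ap; rewrite /x Ap.
    - apply: (ideal_limit_point_cst_on _ _ _ _ (~` A)) => // p.
      by rewrite in_setC /x => /negbTE ->.
  by move/eqP; rewrite oner_eq0.
(* In a Hausdorff space it suffices that any neighbourhoods [U] of [l1] and [V] of [l2] meet. *)
apply: (@norm_hausdorff _ R) => U V Ul1 Vl2.
have [K _ nU] : \forall k \near \oo, U (x (n k)) := nl1 U Ul1.
have [L _ mV] : \forall k \near \oo, V (x (m k)) := ml2 V Vl2.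
apply: contrapT => /nonemptyPn UV0.
have In : I (~` range n) by case: (Idec (range n)).
have Im : I (~` range m) by case: (Idec (range m)).
(* If [U] and [V] are disjoint, no index [p] is both some [n i] with [K <= i] and some [m j] with
   [L <= j]. So the complements of the two ranges and the two finite heads, all in [I], cover every
   index. *)
apply: (ideal_proper hI); apply/seteqP; split=> // B _.
apply: (ideal_subset hI) (ideal_setU hI (ideal_setU hI In Im)
  (ideal_setU hI (ideal_fin hI (finite_range_head n K))
                 (ideal_fin hI (finite_range_head m L)))) => p _.
have [[i _ ip]|] := pselect (range n p); last by left; left.
have [[j _ jp]|] := pselect (range m p); last by left; right.
have [iK|Ki] := ltnP i K; first by right; left; exists i.
have [jL|Lj] := ltnP j L; first by right; right; exists j.
suff : (U `&` V) (x p) by rewrite UV0.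
by split; [rewrite -ip; exact: nU|rewrite -jp; exact: mV].
Qed.
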